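(* For every $(x,y)\in \Lambda\setminus \mathcal O_F^{+}$ there exists a $DF$-invariant unstable direction $E^u(x,y)$.
   Context: Setting. $f$ is a map of $[-1,1]$ with a discontinuity at $0$, given by two branches, each an increasing $\mathcal C^{1+}$-diffeomorphism ($C^1$ with locally Hölder derivative): from $[-1,0[$ onto $[v_l,1[$ and from $]0,1]$ onto $]-1,v_r]$, where $-1<v_l<0<v_r<1$. One has $f'\ge\sqrt2$, and $f'(x)$ is of the form $1/|x|^{1-\rho}$ for $x$ close to $0$, with $\rho\in(0,1)$, so $f'(x)\to+\infty$ as $x\to0^\pm$. At $0$, $f$ is bi-valued: $f(0^-)=1$, $f(0^+)=-1$. The map $g$ is $\mathcal C^{1+}$ from $([-1,0)\cup(0,1])\times[-1,1]$ to $[-1,1]$ and extends to $\{0\}\times[-1,1]$ as a bi-valued map with $g(0^-,y)=y_+>0$ and $g(0^+,y)=y_-<0$ for every $y$, where $y_\pm\in]-1,1[$; moreover $|\partial g/\partial y|\le \frac12$ and $|\partial g/\partial x|\le M$ for some $M>0$. Put $F(x,y)=(f(x),g(x,y))$ on $[-1,1]^2$. $F$ maps $[-1,1]^2$ strictly into itself, maps the left part ($x<0$) and the right part ($x>0$) onto two disjoint ''triangles'', and is one-to-one except on the critical line $\{0\}\times[-1,1]$, whose two images are the points $(1,y_+)$ and $(-1,y_-)$. Standing assumption: $0$ is neither periodic nor pre-periodic for $f$. The attractor is $\Lambda=\bigcap_{n\ge0}F^n([-1,1]^2)$. $\mathcal O_F^+$ (post-critical orbits) is the union of the forward $F$-orbits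 of $(1,y_+)$ and $(-1,y_-)$. For $z\in\Lambda\setminus\mathcal O_F^+$ the preimages $F^{-n}(z)$, $n\ge 1$, are well defined and do not lie on the critical line. A direction is a line through $0$ in $\mathbb R^2$. $DF$-invariance means $DF(z)E^u(z)=E^u(F(z))$ whenever $z\in\Lambda\setminus\mathcal O_F^+$ is not on the critical line (equivalently $DF(F^{-1}(z))E^u(F^{-1}(z))=E^u(z)$ for every $z\in \Lambda\setminus\mathcal O_F^+$). Unstable means that vectors of $E^u(z)$ are contracted exponentially under backward iteration: if $v\in E^u(z)$ and $v_{-n}\in E^u(F^{-n}(z))$ satisfies $DF^n(F^{-n}(z))v_{-n}=v$, then $\|v_{-n}\|\to0$ exponentially fast as $n\to\infty$. *)

(* Defs.v *)
From HB Require Import structures.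
From mathcomp Require Import all_boot all_order all_algebra.
From mathcomp Require Import all_classical all_reals all_analysis.
Import Order.TTheory GRing.Theory Num.Theory.
Import numFieldNormedType.Exports.

Set Implicit Arguments.
Unset Strict Implicit.
Unset Printing Implicit Defensive.

Local Open Scope classical_set_scope.
Local Open Scope ring_scope.

(* Derivatives are taken relative to the domain [A], hence are one-sided at
   those of its endpoints that belong to it.  Here [h] may take arbitrary
   values outside [A]. *)
Definition quotient_within (R : realType) (A : set R) (h : R -> R) (x : R) :=
  (fun t : R => (h t - h x) / (t - x)) @ within A x^'.

Definition derivable_on (R : realType) (A : set R) (h : R -> R) (x : R) : Prop :=
  cvg (quotient_within A h x).

Definition deriv_on (R : realType) (A : set R) (h : R -> R) (x : R) : R :=
  lim (quotient_within A h x).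

Definition locally_holder (R : realType) (T : normedModType R) (A : set T)
    (h : T -> R) : Prop :=
  forall x, A x -> exists a C : R, [/\ 0 < a, a <= 1 &
    exists2 U, nbhs x U & forall s t, (A `&` U) s -> (A `&` U) t ->
      `|h s - h t| <= C * `|s - t| `^ a].

Definition C1plus (R : realType) (A : set R) (h : R -> R) : Prop :=
  (forall x, A x -> derivable_on A h x) /\
  @locally_holder R R^o A (deriv_on A h).

Definition C1plus_diffeo (R : realType) (A B : set R) (h : R -> R) : Prop :=
  [/\ set_bij A B h, C1plus A h &
      exists2 k : R -> R, (forall x, A x -> k (h x) = x) & C1plus B k].

Section Domains.
Context {R : realType}.

Definition left_int : set R := `[-1, 0[.
Definition right_int : set R := `]0, 1].
Definition unit_int : set R := `[-1, 1].
Definition punctured_int : set R := left_int `|` right_int.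
Definition square : set (R * R) := unit_int `*` unit_int.
Definition slit_square : set (R * R) := punctured_int `*` unit_int.

End Domains.

(* Only the restrictions of [f] to [punctured_int] and of [g] to [slit_square]
   are meaningful; on the critical line they are replaced by the two one-sided
   values, see [f_step] and [F_step]. *)
Record lorenz_data (R : realType) := LorenzData {
  f : R -> R;
  g : R * R -> R;
  v_l : R;
  v_r : R;
  rho : R;
  y_plus : R;
  y_minus : R;
  M : R
}.

Section Dynamics.
Context {R : realType} (D : lorenz_data R).

Definition f_step (x x' : R) : Prop :=
  if x == 0 then x' = 1 \/ x' = -1 else x' = f D x.

(* [k = 0] is periodicity, [k > 0] pre-periodicity; an orbit that meets [0]
   may continue through either value of [f] at [0]. *)
Definition periodic_or_preperiodic (x : R) : Prop :=
  exists u : nat -> R, [/\ u 0%N = x, (forall n, f_step (u n) (u n.+1)) &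
    exists k p : nat, (0 < p)%N /\ u (k + p)%N = u k].

Definition F (z : R * R) : R * R := (f D z.1, g D z).

Definition F_step (z w : R * R) : Prop :=
  if z.1 == 0 then w = (1, y_plus D) \/ w = (-1, y_minus D) else w = F z.

Definition F_image (A : set (R * R)) : set (R * R) :=
  [set w | exists2 z, A z & F_step z w].

Definition attractor : set (R * R) := \bigcap_n iter n F_image square.

Definition postcritical : set (R * R) :=
  \bigcup_n iter n F_image [set (1, y_plus D); (-1, y_minus D)].

Definition regular_part : set (R * R) := attractor `\` postcritical.

(* The point of the square mapped to [z]; it exists, is unique and is off the
   critical line when [z] is in [regular_part]. *)
Definition F_inv (z : R * R) : R * R :=
  get [set w | square w /\ F_step w z].

Definition dfdx (x : R) : R := deriv_on punctured_int (f D) x.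
Definition dgdx (z : R * R) : R :=
  deriv_on punctured_int (fun x => g D (x, z.2)) z.1.
Definition dgdy (z : R * R) : R :=
  deriv_on unit_int (fun y => g D (z.1, y)) z.2.

Definition DF (z : R * R) : 'M[R]_2 :=
  \matrix_(i < 2, j < 2)
    if i == ord0 then (if j == ord0 then dfdx z.1 else 0)
    else (if j == ord0 then dgdx z else dgdy z).

Fixpoint DF_iter (n : nat) (z : R * R) : 'M[R]_2 :=
  if n is m.+1 then DF_iter m (F z) *m DF z else 1%:M.

Record lorenz_axioms : Prop := LorenzAxioms {
  v_l_bounds : -1 < v_l D < 0;
  v_r_bounds : 0 < v_r D < 1;
  f_left_incr : {in left_int &, {homo f D : x y / x < y}};
  f_right_incr : {in right_int &, {homo f D : x y / x < y}};
  f_left_diffeo : C1plus_diffeo left_int `[v_l D, 1[ (f D);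
  f_right_diffeo : C1plus_diffeo right_int `]-1, v_r D] (f D);
  f_expanding : forall x, punctured_int x -> Num.sqrt 2 <= dfdx x;
  rho_bounds : 0 < rho D < 1;
  f_singularity : \forall x \near 0^', dfdx x = 1 / `|x| `^ (1 - rho D);
  g_range : forall z, slit_square z -> unit_int (g D z);
  g_derivable_x : forall x y, slit_square (x, y) ->
    derivable_on punctured_int (fun t => g D (t, y)) x;
  g_derivable_y : forall x y, slit_square (x, y) ->
    derivable_on unit_int (fun t => g D (x, t)) y;
  g_holder_x : @locally_holder R (R^o * R^o)%type slit_square dgdx;
  g_holder_y : @locally_holder R (R^o * R^o)%type slit_square dgdy;
  y_plus_bounds : 0 < y_plus D < 1;
  y_minus_bounds : -1 < y_minus D < 0;
  g_left_limit : forall y, unit_int y -> g D (x, y) @[x --> 0^'-] --> y_plus D;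
  g_right_limit : forall y, unit_int y -> g D (x, y) @[x --> 0^'+] --> y_minus D;
  M_gt0 : 0 < M D;
  dgdy_bound : forall z, slit_square z -> `|dgdy z| <= 2^-1;
  dgdx_bound : forall z, slit_square z -> `|dgdx z| <= M D;
  F_into : F_image square `<` square;
  F_disjoint : F @` (left_int `*` unit_int) `&` F @` (right_int `*` unit_int)
               = set0;
  F_inj : set_inj slit_square F;
  zero_not_preperiodic : ~ periodic_or_preperiodic 0
}.

Definition is_direction (V : {vspace 'cV[R]_2}) : Prop := (\dim V = 1)%N.

Definition DF_invariant (E : R * R -> {vspace 'cV[R]_2}) : Prop :=
  forall z, regular_part z -> z.1 != 0 ->
    (linfun (mulmx (DF z)) @: E z)%VS = E (F z).

(* The norm is the sup norm on R^2; the constants may depend on [z] and [v]. *)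
Definition unstable_at (E : R * R -> {vspace 'cV[R]_2}) (z : R * R) : Prop :=
  forall (v : 'cV[R]_2) (w : nat -> 'cV[R]_2), v \in E z ->
    (forall n, w n \in E (iter n F_inv z) /\
               DF_iter n (iter n F_inv z) *m w n = v) ->
    exists C lambda : R, 0 < lambda < 1 /\
      forall n, `|w n| <= C * lambda ^+ n.

End Dynamics.

(* Main.v *)
(** A line spanned by [(1, s)] is mapped by [DF z] to the line spanned by
    [(1, (dg/dx + s dg/dy) / f')].  This map on slopes is affine, contracts by
    the factor [1/2] and has a constant term bounded by [M].  Pulling the slope
    [0] back to [F^{-n} z] and pushing it forward [n] times therefore converges
    to a bounded invariant slope [s z].  On the resulting field of directions,
    expansion can be read off the first coordinate, which [DF] multiplies by
    [f' >= sqrt 2]. *)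
Require Import Defs.
From mathcomp Require Import all_boot all_order all_algebra.
From mathcomp Require Import all_classical all_reals all_analysis.
From mathcomp Require Import ring lra.
Import Order.TTheory GRing.Theory Num.Theory.
Import numFieldNormedType.Exports.

Set Implicit Arguments.
Unset Strict Implicit.
Unset Printing Implicit Defensive.

Local Open Scope classical_set_scope.
Local Open Scope ring_scope.

(** * Sequences with geometrically small increments *)

Section GeometricIncrements.
Context {R : realType}.

Lemma geometric_increments_cvg (u : R^nat) (c q : R) :
    0 <= q -> q < 1 -> (forall n, `|u n.+1 - u n| <= c * q ^+ n) ->
  cvgn u.
Proof.
move=> q0 q1 le_cq.
have c0 : 0 <= c by have := le_cq 0%N; rewrite expr0 mulr1; exact: le_trans.
(* The increments are dominated by a convergent geometric series, and [u] is [u 0] plus their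
   partial sums. *)
have cvgt : cvgn (series (telescope u)).
  apply: normed_cvg; apply: (@series_le_cvg _ _ (geometric c q)) => //=.
  - by move=> n; rewrite /geometric /= mulr_ge0 ?exprn_ge0.
  - by apply: is_cvg_geometric_series; rewrite ger0_norm.
have -> : u = (fun n => u 0%N + series (telescope u) n).
  by apply/funext => n; exact: eq_sum_telescope.
by apply: is_cvgD; first exact: is_cvg_cst.
Qed.

Lemma norm_limn_le (u : R^nat) (b : R) :
  cvgn u -> (forall n, `|u n| <= b) -> `|limn u| <= b.
Proof.
move=> cu le_b; rewrite ler_norml; apply/andP; split.
  by apply: limr_ge => //; apply: nearW => n; case/ler_normlP: (le_b n) => ? ?; lra.
by apply: limr_le => //; apply: nearW => n; case/ler_normlP: (le_b n) => ? ?; lra.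
Qed.

End GeometricIncrements.

(** * Backward orbits of regular points *)

Section LorenzMap.
Context {R : realType} (D : lorenz_data R) (HD : lorenz_axioms D).

Lemma sqrt2_gt1 : 1 < Num.sqrt 2 :> R.
Proof. by rewrite -[X in X < _]sqrtr1 ltr_sqrt ?ltr1n. Qed.

Lemma slit_squareE (z : R * R) : slit_square z <-> square z /\ z.1 != 0.
Proof.
case: z => x y; split.
  rewrite /slit_square /square /unit_int => -[/= hx hy].
  by case: hx; rewrite /left_int /right_int /= in_itv /= => /andP[h1 h2];
    (split; [split => //=; rewrite in_itv /=; lra | by [rewrite lt_eqF | rewrite gt_eqF]]).
case=> -[/= hx hy] x0; split => //=; move: hx; rewrite /unit_int /= in_itv /=.
move=> /andP[h1 h2]; rewrite /punctured_int /left_int /right_int /= !in_itv /=.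
by case: (ltgtP x 0) x0 => //; [left|right]; lra.
Qed.

(** Both branches miss the values 1 and -1; this separates [F z], for [z] off the critical line,
    from the two images of that line. *)
Lemma f_interior x : punctured_int x -> -1 < f D x < 1.
Proof.
have /andP[vl _] := v_l_bounds HD; have /andP[_ vr] := v_r_bounds HD.
have [[fl _ _] _ _] := f_left_diffeo HD; have [[fr _ _] _ _] := f_right_diffeo HD.
case=> [/fl|/fr] /=; rewrite in_itv /= => /andP[h1 h2]; lra.
Qed.

Lemma F_step_slit (z w : R * R) : z.1 != 0 -> F_step D z w -> w = F D z.
Proof. by rewrite /F_step => /negPf ->. Qed.

Lemma F_step_F (z : R * R) : z.1 != 0 -> F_step D z (F D z).
Proof. by rewrite /F_step => /negPf ->. Qed.

Lemma F_step_critical (z w : R * R) :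
  z.1 = 0 -> F_step D z w -> w = (1, y_plus D) \/ w = (-1, y_minus D).
Proof. by rewrite /F_step => ->; rewrite eqxx. Qed.

Lemma F_invK (z : R * R) : slit_square z -> F_inv D (F D z) = z.
Proof.
move=> sz; have [qz z0] := (slit_squareE z).1 sz.
apply: get_unique => [|w [qw zw]]; first by split => //; exact: F_step_F.
have [w0|w0] := eqVneq w.1 0.
  (* A critical preimage would force the first coordinate of [F z] to be 1 or -1. *)
  exfalso; have := f_interior sz.1.
  by case: (F_step_critical w0 zw) => -[-> _]; lra.
have sw : slit_square w by apply/slit_squareE.
by apply: (F_inj HD); rewrite ?inE // (F_step_slit w0 zw).
Qed.

Lemma iter_F_image_square n : iter n (F_image D) square `<=` square.
Proof.
elim: n => // n IH w [z /IH qz zw]; apply: (properW (F_into HD)).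
by exists z.
Qed.

(** A preimage on the critical line would make [z] post-critical. Hence every preimage of [z] in the
    square lies off that line, where [F] is injective, so it is unique. *)
Lemma regular_part_F_inv z : regular_part D z ->
  [/\ regular_part D (F_inv D z), slit_square (F_inv D z) &
      F D (F_inv D z) = z].
Proof.
move=> [az npz].
have slit_preimage w : square w -> F_step D w z -> slit_square w.
  move=> qw wz; apply/slit_squareE; split => //; apply/eqP => w0.
  by apply: npz; exists 0%N => //; exact: F_step_critical wz.
have [w qw wz] : F_image D square z by exact: (az 1%N).
have sw := slit_preimage _ qw wz.
have w0 := ((slit_squareE w).1 sw).2.
have zE := F_step_slit w0 wz.
have iz : F_inv D z = w by rewrite zE F_invK.
rewrite iz; split => //; split => [n _|[n _ pw]].
  (* Membership of [z] in the image of order [n.+1] yields a preimage in the image of order [n]; by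
     uniqueness it is [w]. *)
  have [w' qw' wz'] : iter n.+1 (F_image D) square z by exact: (az n.+1).
  have sw' := slit_preimage _ (iter_F_image_square qw') wz'.
  suff -> : w = w' by [].
  rewrite -iz (F_step_slit ((slit_squareE w').1 sw').2 wz').
  exact: F_invK.
by apply: npz; exists n.+1 => //; exists w.
Qed.

Lemma regular_part_iter_F_inv n z :
  regular_part D z -> regular_part D (iter n (F_inv D) z).
Proof. by move=> rz; elim: n => //= n /regular_part_F_inv[]. Qed.

(** * The invariant slope *)

Lemma dfdx_gt1 z : slit_square z -> 1 < dfdx D z.1.
Proof. by case=> /(f_expanding HD) + _; exact: lt_le_trans sqrt2_gt1. Qed.

Lemma dfdx_neq0 z : slit_square z -> dfdx D z.1 != 0.
Proof. by move=> /dfdx_gt1 df1; rewrite gt_eqF // (lt_trans ltr01). Qed.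

Definition slope_map (z : R * R) (s : R) : R :=
  (dgdx D z + dgdy D z * s) / dfdx D z.1.

Lemma norm_div_dfdx_le z a : slit_square z -> `|a / dfdx D z.1| <= `|a|.
Proof.
move=> sz; have df1 := dfdx_gt1 sz; have df0 := lt_trans ltr01 df1.
rewrite normrM normfV (gtr0_norm df0) ler_pdivrMr //.
by rewrite ler_peMr // ltW.
Qed.

Lemma slope_map0_bound z : slit_square z -> `|slope_map z 0| <= M D.
Proof.
move=> sz; rewrite /slope_map mulr0 addr0.
exact: le_trans (norm_div_dfdx_le _ sz) (dgdx_bound HD sz).
Qed.

Lemma slope_map_contraction z s t : slit_square z ->
  `|slope_map z s - slope_map z t| <= 2^-1 * `|s - t|.
Proof.
move=> sz; have -> : slope_map z s - slope_map z t
    = dgdy D z * (s - t) / dfdx D z.1.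
  by rewrite /slope_map -mulrBl; congr (_ / _); ring.
apply: le_trans (norm_div_dfdx_le _ sz) _.
by rewrite normrM ler_wpM2r // (dgdy_bound HD).
Qed.

(** The recursion peels off the backward step nearest to [z], so replacing [z] by [F z] only adds
    one outermost [slope_map]. *)
Fixpoint slope_iter (n : nat) (z : R * R) : R :=
  if n is m.+1 then slope_map (F_inv D z) (slope_iter m (F_inv D z)) else 0.

Definition slope (z : R * R) : R := limn (slope_iter ^~ z).

(** Both terms end with the same [slope_map] at [F_inv z], so each induction step gains a factor 1/2
    while moving the base point backward. *)
Lemma slope_iter_increment n z : regular_part D z ->
  `|slope_iter n.+1 z - slope_iter n z| <= M D * 2^-1 ^+ n.
Proof.
elim: n z => [|n IH] z /regular_part_F_inv[rz sz _].
  by rewrite expr0 mulr1 subr0; exact: slope_map0_bound.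
apply: le_trans (slope_map_contraction _ _ sz) _.
by rewrite exprS mulrCA ler_wpM2l ?invr_ge0 // IH.
Qed.

(** The interval of radius [2 * M] is preserved, since [M + (2 * M) / 2 = 2 * M]. *)
Lemma slope_iter_bound n z : regular_part D z -> `|slope_iter n z| <= 2 * M D.
Proof.
elim: n z => [|n IH] z rz; first by rewrite normr0 mulr_ge0 // ltW // (M_gt0 HD).
have [rz' sz _] := regular_part_F_inv rz.
have := slope_map_contraction (slope_iter n (F_inv D z)) 0 sz.
have := slope_map0_bound sz; have := IH _ rz'.
rewrite subr0 /=; set a := slope_map _ _; set b := slope_map _ _ => h1 h2 h3.
have := ler_normD (b - a) a; rewrite subrK; lra.
Qed.

Lemma slope_iter_cvg z : regular_part D z -> cvgn (slope_iter ^~ z).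
Proof.
move=> rz; apply: (@geometric_increments_cvg _ _ (M D) 2^-1) => [||n].
- by rewrite invr_ge0.
- by rewrite invf_lt1 // ltr1n.
- exact: slope_iter_increment.
Qed.

Lemma slope_bound z : regular_part D z -> `|slope z| <= 2 * M D.
Proof.
move=> rz; apply: norm_limn_le; first exact: slope_iter_cvg.
by move=> n; exact: slope_iter_bound.
Qed.

Lemma slope_F z : regular_part D z -> z.1 != 0 ->
  slope (F D z) = slope_map z (slope z).
Proof.
move=> rz z0; have sz : slit_square z.
  by apply/slit_squareE; split => //; exact: (rz.1 0%N).
(* After a shift of the index by one, the sequence at [F z] is the affine map [slope_map z] applied
   to the sequence at [z]. *)
apply: cvg_lim => //; rewrite -(cvg_shiftS (slope_iter ^~ (F D z))) /=.
rewrite F_invK //; apply: cvgM; last exact: cvg_cst.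
apply: cvgD; first exact: cvg_cst.
by apply: cvgM; [exact: cvg_cst|exact: slope_iter_cvg].
Qed.

(** * The direction field and its expansion *)

Definition slope_vec (s : R) : 'cV[R]_2 :=
  \col_(i < 2) if i == ord0 then 1 else s.

Lemma slope_vec_neq0 s : slope_vec s != 0.
Proof.
by apply/eqP => /matrixP/(_ ord0 ord0)/eqP; rewrite !mxE eqxx oner_eq0.
Qed.

Lemma norm_slope_vec_le s : `|slope_vec s| <= Num.max 1 `|s|.
Proof.
rewrite [`|_|]mx_normrE; apply/bigmax_leP; split=> [|[i j] _ /=].
  by rewrite le_max ler01.
by rewrite mxE; case: (i == ord0); rewrite le_max ?normr1 lexx ?orbT.
Qed.

Lemma DF_slope_vec z s : slit_square z ->
  DF D z *m slope_vec s = dfdx D z.1 *: slope_vec (slope_map z s).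
Proof.
move=> sz; have df0 := dfdx_neq0 sz.
apply/matrixP => i j; rewrite !mxE big_ord_recl big_ord1 !mxE /=.
case: (i == ord0); first by rewrite mul0r addr0.
by rewrite mulrCA divff // !mulr1.
Qed.

Definition unstable_dir (z : R * R) : {vspace 'cV[R]_2} :=
  <[slope_vec (slope z)]>%VS.

Lemma unstable_dir_invariant : DF_invariant D unstable_dir.
Proof.
move=> z rz z0; have sz : slit_square z.
  by apply/slit_squareE; split => //; exact: (rz.1 0%N).
rewrite /unstable_dir limg_line lfunE /= DF_slope_vec // -slope_F //.
have df0 := dfdx_neq0 sz.
apply/vspaceP => v; apply/vlineP/vlineP => -[k ->].
  by exists (k * dfdx D z.1); rewrite scalerA.
by exists (k / dfdx D z.1); rewrite scalerA divfK.
Qed.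

(** The first row of [DF] is [(f', 0)], so the first coordinate of any vector, whatever its
    direction, is multiplied by [f'] at each step. *)
Lemma DF_iter_expansion n z (w : 'cV[R]_2) : regular_part D z ->
  Num.sqrt 2 ^+ n * `|w ord0 ord0| <=
    `|(DF_iter D n (iter n (F_inv D) z) *m w) ord0 ord0|.
Proof.
move=> rz; elim: n w => [|n IH] w; first by rewrite mul1r mul1mx.
(* One application of [F] to the preimage of order [n.+1] returns the preimage of order [n], where
   the induction hypothesis applies. *)
have [_ sz /= ->] := regular_part_F_inv (regular_part_iter_F_inv n rz).
rewrite -mulmxA; apply: le_trans (IH _); rewrite exprSr -mulrA.
rewrite ler_wpM2l ?exprn_ge0 ?sqrtr_ge0 //.
rewrite !mxE big_ord_recl big_ord1 !mxE /= mul0r addr0 normrM.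
rewrite ler_wpM2r // (le_trans _ (ler_norm _)) //.
exact: (f_expanding HD sz.1).
Qed.

Lemma unstable_dir_unstable z : regular_part D z -> unstable_at D unstable_dir z.
Proof.
move=> rz v w _ wE; have sqrt2_gt0 := lt_trans ltr01 sqrt2_gt1.
(* Expansion controls the first coordinate of [w n]; the uniform bound [2 * M] on slopes then
   controls its whole norm, up to the factor [Num.max 1 (2 * M D)]. *)
exists (`|v ord0 ord0| * Num.max 1 (2 * M D)), (Num.sqrt 2)^-1; split.
  by rewrite invr_gt0 sqrt2_gt0 invf_lt1 // sqrt2_gt1.
move=> n; have [/vlineP[c wnE] DFwn] := wE n.
have w0 : w n ord0 ord0 = c by rewrite wnE !mxE eqxx mulr1.
have := DF_iter_expansion n (w n) rz; rewrite DFwn w0 => cv.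
rewrite wnE normrZ exprVn mulrAC ler_pM //.
  by rewrite ler_pdivlMr ?exprn_gt0 // mulrC.
apply: le_trans (norm_slope_vec_le _) _.
rewrite ge_max !le_max lexx /=; apply/orP; right.
exact: slope_bound (regular_part_iter_F_inv n rz).
Qed.

End LorenzMap.

Theorem theoremA (R : realType) (D : lorenz_data R) (HD : lorenz_axioms D) :
  exists E : R * R -> {vspace 'cV[R]_2},
    DF_invariant D E /\
    forall z : R * R, regular_part D z ->
      is_direction (E z) /\ unstable_at D E z.
Proof.
exists (unstable_dir D); split; first exact: unstable_dir_invariant.
move=> z rz; split; last exact: unstable_dir_unstable.
by rewrite /is_direction dim_vline slope_vec_neq0.
Qed.
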